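(* Let $m\ge 1$, let $p\in\mathbb{R}^m$ be nonzero, let $\alpha>0$, and let $x,\hat{x}\in\mathbb{R}^{24}$. Let $A=\frac{1}{\alpha\|p\|_2^2}\,x p^T$ and $\hat{A}=\frac{1}{\alpha\|p\|_2^2}\,\hat{x} p^T$ be the minimum Frobenius norm PLD matrices of $x$ and $\hat{x}$. Let $\tilde{A}\in\mathbb{R}^{24\times m}$ be a nonzero matrix with $\tilde{A}\,\alpha p = x$, and write $\tilde{A}=A+H$, where $H$ has rank $R_H$ and maximum singular value $\sigma_1$. Then $$\sqrt{\frac{\|\hat{x}-x\|_2^2+\|\alpha p\|_2^2\,\sigma_1^2}{\|x\|_2^2+\|\alpha p\|_2^2\,R_H\,\sigma_1^2}}\;\le\;\frac{\|\hat{A}-\tilde{A}\|_F}{\|\tilde{A}\|_F}\;\le\;\sqrt{\frac{\|\hat{x}-x\|_2^2+\|\alpha p\|_2^2\,R_H\,\sigma_1^2}{\|x\|_2^2+\|\alpha p\|_2^2\,\sigma_1^2}}.$$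
   Context: $x$ is the actual 24-hour load curve of a household, $\hat{x}$ is a predicted load curve, $p$ is the vector of power levels of the $m$ devices and $\alpha>0$ is a scaling of units. For a load curve $y\in\mathbb{R}^{24}$, its PLD (power level decomposition) matrix is the minimizer of $\|B\|_F$ over matrices $B\in\mathbb{R}^{24\times m}$ with $B\,\alpha p=y$; its closed form is $\frac{1}{\alpha\|p\|_2^2}\,y p^T$. The matrix $\tilde{A}$ is the actual (unknown) appliance usage matrix, which reproduces the load curve: $\tilde{A}\,\alpha p=x$. $\|\cdot\|_F$ is the Frobenius norm. If $H=0$, then $R_H=0$ and $\sigma_1=0$. *)

(* Defs.v *)
From HB Require Import structures.
From mathcomp Require Import all_boot all_order all_algebra.
From mathcomp Require Import classical_sets reals.
Set Implicit Arguments.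
Unset Strict Implicit.
Unset Printing Implicit Defensive.
Import Order.TTheory GRing.Theory Num.Theory.
Local Open Scope ring_scope.
Local Open Scope classical_set_scope.

Definition l2norm (R : realType) (n : nat) (v : 'cV[R]_n) : R :=
  Num.sqrt (\sum_(i < n) v i 0 ^+ 2).

Definition frobenius (R : realType) (m n : nat) (B : 'M[R]_(m, n)) : R :=
  Num.sqrt (\sum_(i < m) \sum_(j < n) B i j ^+ 2).

(* The eigenvalues of B^T B include 0 whenever n > m, so for a wide B of full
   rank this set may contain an extra 0; the largest element is unaffected. *)
Definition singular_values (R : realType) (m n : nat) (B : 'M[R]_(m, n)) :
    set R :=
  [set s | 0 <= s /\ eigenvalue (B^T *m B) (s ^+ 2)].

(* For n > 0 the set is finite and nonempty, so sup is its maximum. *)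
Definition max_singular_value (R : realType) (m n : nat) (B : 'M[R]_(m, n)) :
    R :=
  sup (singular_values B).

Definition is_PLD (R : realType) (n m : nat) (alpha : R) (p : 'cV[R]_m)
    (y : 'cV[R]_n) (B : 'M[R]_(n, m)) : Prop :=
  B *m (alpha *: p) = y /\
  forall C : 'M[R]_(n, m), C *m (alpha *: p) = y -> frobenius B <= frobenius C.

(* The closed form; is_PLDP shows that it is the unique minimizer is_PLD. *)
Definition PLD (R : realType) (n m : nat) (alpha : R) (p : 'cV[R]_m)
    (y : 'cV[R]_n) : 'M[R]_(n, m) :=
  (alpha * l2norm p ^+ 2)^-1 *: (y *m p^T).

Section PLDP.
Variables (R : realType) (n m : nat) (alpha : R) (p : 'cV[R]_m).
Hypotheses (alpha_gt0 : 0 < alpha) (p_neq0 : p != 0).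

Let sqr_l2norm : (l2norm p ^+ 2)%:M = p^T *m p.
Proof.
rewrite /l2norm sqr_sqrtr; last by apply: sumr_ge0 => i _; exact: sqr_ge0.
apply/matrixP => i j; rewrite !ord1 !mxE mulr1n.
by apply: eq_bigr => k _; rewrite !mxE expr2.
Qed.

Let l2norm_neq0 : l2norm p ^+ 2 != 0.
Proof.
apply: contra_neq p_neq0 => /eqP.
rewrite /l2norm sqr_sqrtr; last by apply: sumr_ge0 => i _; exact: sqr_ge0.
rewrite psumr_eq0 => [/allP h|i _]; last exact: sqr_ge0.
apply/matrixP => i j; rewrite ord1 mxE.
by apply/eqP; rewrite -sqrf_eq0; exact: h (mem_index_enum i).
Qed.

Let PLD_eq (y : 'cV[R]_n) : PLD alpha p y *m (alpha *: p) = y.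
Proof.
rewrite /PLD -scalemxAl -scalemxAr scalerA -mulmxA -sqr_l2norm mul_mx_scalar.
rewrite scalerA -mulrA mulVf ?scale1r// mulf_neq0//; exact: lt0r_neq0.
Qed.

Let frobeniusE (B : 'M[R]_(n, m)) :
  frobenius B = Num.sqrt (\tr (B *m B^T)).
Proof.
congr Num.sqrt; apply: eq_bigr => i _; rewrite mxE.
by apply: eq_bigr => j _; rewrite !mxE expr2.
Qed.

Let tr_ge0 (B : 'M[R]_(n, m)) : 0 <= \tr (B *m B^T).
Proof.
apply: sumr_ge0 => i _; rewrite mxE; apply: sumr_ge0 => j _.
by rewrite mxE -expr2 sqr_ge0.
Qed.

Let tr_eq0 (B : 'M[R]_(n, m)) : \tr (B *m B^T) <= 0 -> B = 0.
Proof.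
move=> B0; have /eqP : \tr (B *m B^T) = 0 by apply/le_anti; rewrite B0 tr_ge0.
have hi i : 0 <= (B *m B^T) i i.
  by rewrite mxE; apply: sumr_ge0 => j _; rewrite mxE -expr2 sqr_ge0.
rewrite psumr_eq0// => /allP h; apply/matrixP => i j; rewrite mxE.
move: (h i (mem_index_enum i)); rewrite /= mxE psumr_eq0 => [/allP h'|k _].
  move: (h' j (mem_index_enum j)).
  by rewrite /= mxE -expr2 sqrf_eq0 => /eqP.
by rewrite mxE -expr2 sqr_ge0.
Qed.

Let PLD_pyth (y : 'cV[R]_n) (C : 'M[R]_(n, m)) : C *m (alpha *: p) = y ->
  \tr (C *m C^T) = \tr (PLD alpha p y *m (PLD alpha p y)^T)
    + \tr ((C - PLD alpha p y) *m (C - PLD alpha p y)^T).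
Proof.
move=> Cy; set A := PLD alpha p y; set K := C - A.
have -> : C = A + K by rewrite addrC subrK.
have Kp : K *m p = 0.
  have : K *m (alpha *: p) = 0 by rewrite mulmxBl Cy PLD_eq subrr.
  rewrite -scalemxAr => /eqP; rewrite scaler_eq0 => /orP[|/eqP//].
  by rewrite gt_eqF.
have KA : K *m A^T = 0.
  by rewrite /A /PLD linearZ/= trmx_mul trmxK -scalemxAr mulmxA Kp mul0mx scaler0.
have AK : A *m K^T = 0 by rewrite -[A]trmxK -trmx_mul KA trmx0.
by rewrite linearD/= mulmxDl !mulmxDr KA AK addr0 add0r mxtraceD.
Qed.

Lemma is_PLDP (y : 'cV[R]_n) (B : 'M[R]_(n, m)) :
  is_PLD alpha p y B <-> B = PLD alpha p y.
Proof.
split=> [[By Bmin]|->]; last first.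
  split=> [|C Cy]; first exact: PLD_eq.
  by rewrite !frobeniusE ler_wsqrtr// (PLD_pyth Cy) lerDl tr_ge0.
move: (Bmin _ (PLD_eq y)); rewrite !frobeniusE ler_sqrt ?tr_ge0//.
rewrite (PLD_pyth By) gerDl => /tr_eq0 /eqP.
by rewrite subr_eq0 => /eqP.
Qed.

End PLDP.

(* Main.v *)
Require Import Defs.
From HB Require Import structures.
From mathcomp Require Import all_boot all_order all_algebra.
From mathcomp Require Import sesquilinear spectral complex.
From mathcomp Require Import classical_sets reals.
From mathcomp Require Import ring lra.

(** The spectral theorem for H^T H, obtained over R[i], gives nonnegative real
    eigenvalues d_i with sum ||H||_F^2, maximum sigma_1^2, and at most rank H of
    them nonzero; hence sigma_1^2 <= ||H||_F^2 <= rank H * sigma_1^2.  Since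
    H p = 0, every PLD matrix is Frobenius-orthogonal to H, so by Pythagoras
    the squared error ratio is
    (||xhat - x||^2 + ||alpha p||^2 ||H||_F^2)
      / (||x||^2 + ||alpha p||^2 ||H||_F^2),
    and the two bounds on ||H||_F^2 give the claim. *)

Set Implicit Arguments.
Unset Strict Implicit.
Unset Printing Implicit Defensive.
Import Order.TTheory GRing.Theory Num.Theory.
Local Open Scope ring_scope.

(** * Spectral theorem for real symmetric matrices *)

(** The scalar matrix ['X] commutes with conjugation by [P], and the determinants of [P] and its
    inverse cancel. *)
Lemma char_poly_similar (F : fieldType) (n : nat) (P M : 'M[F]_n) :
  P \in unitmx -> char_poly (invmx P *m M *m P) = char_poly M.
Proof.
move=> Pu; rewrite /char_poly.
have -> : char_poly_mx (invmx P *m M *m P) =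
    map_mx polyC (invmx P) *m char_poly_mx M *m map_mx polyC P.
  rewrite /char_poly_mx mulmxBr mulmxBl !map_mxM; congr (_ - _).
  by rewrite scalar_mxC -mulmxA -map_mxM mulVmx // map_mx1 mulmx1.
rewrite !det_mulmx mulrAC -det_mulmx -map_mxM mulVmx // map_mx1 det1.
by rewrite mul1r.
Qed.

(** Keeping only the indices of nonzero entries leaves an invertible diagonal submatrix, and a
    submatrix cannot have larger rank. This will count the nonzero eigenvalues. *)
Lemma card_neq0_rank_diag (F : fieldType) (n : nat) (d : 'rV[F]_n) :
  (#|[pred i | d ord0 i != 0%R]| <= \rank (diag_mx d))%N.
Proof.
set P := [pred i | _]; pose f (k : 'I_#|P|) : 'I_n := enum_val k.
have -> : #|P| = \rank (mxsub f f (diag_mx d)).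
  have -> : mxsub f f (diag_mx d) = diag_mx (colsub f d).
    by apply/matrixP => i j; rewrite !mxE (inj_eq enum_val_inj).
  rewrite mxrank_unit // unitmxE det_diag unitfE; apply/prodf_neq0 => k _.
  by rewrite mxE; have := enum_valP k.
(* Selecting rows and columns is multiplication by submatrices of the identity, which does not raise
   the rank. *)
have -> : mxsub f f (diag_mx d) =
    rowsub f 1%:M *m diag_mx d *m colsub f 1%:M.
  by rewrite -rowsubE mulmx_colsub mulmx1; apply/matrixP=> i j; rewrite !mxE.
exact: leq_trans (mxrankM_maxl _ _) (mxrankM_maxr _ _).
Qed.

(** Over [R[i]] the matrix is Hermitian, hence unitarily diagonalizable with real eigenvalues. Each
    of the three identities then descends along the injective embedding of [R]. Factoring
    [char_poly] keeps the multiplicities. *)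
Lemma symmetric_spectrum (R : rcfType) (n : nat) (M : 'M[R]_n) : M^T = M ->
  exists d : 'rV[R]_n,
    [/\ char_poly M = \prod_i ('X - (d ord0 i)%:P),
        \tr M = \sum_i d ord0 i
      & \rank M = \rank (diag_mx d)].
Proof.
move=> Msym; pose toC : {rmorphism R -> R[i]} := real_complex R.
pose MC := map_mx toC M.
have MCh : MC \is hermsymmx.
  apply: realsym_hermsym.
    apply/is_hermitianmxP.
    by rewrite expr0 scale1r map_mx_id // /MC map_trmx Msym.
  by apply/mxOverP => i j; rewrite mxE; apply/complex_realP; exists (M i j).
have /orthomx_spectralP := hermitian_normalmx MCh.
set P := spectralmx MC; set D := spectral_diag MC => MCE.
have Pu : P \in unitmx := spectral_unit MC.
(* The spectrum of a Hermitian matrix is real, so taking real parts loses nothing. *)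
pose d : 'rV[R]_n := map_mx (@complex.Re R) D.
have DE : D = map_mx toC d.
  apply/matrixP => i j; rewrite !mxE [RHS]RRe_real //.
  exact: (mxOverP (hermitian_spectral_diag_real MCh)).
exists d; split.
- apply: (map_poly_inj toC).
  rewrite map_char_poly -/MC MCE char_poly_similar //.
  rewrite char_poly_trig ?diag_mx_is_trig // rmorph_prod /=.
  apply: eq_bigr => i _.
  by rewrite rmorphB /= map_polyX map_polyC DE !mxE eqxx mulr1n.
- apply: complexI; rewrite -[LHS]/(toC (\tr M)) -[RHS]/(toC (\sum_i d ord0 i)).
  rewrite -trace_map_mx -/MC MCE mxtrace_mulC mulmxA mulmxV // mul1mx.
  by rewrite mxtrace_diag rmorph_sum DE; apply: eq_bigr => i _; rewrite !mxE.
rewrite -(mxrank_map toC) -/MC MCE -(mxrank_map toC) map_diag_mx -DE.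
by rewrite mxrankMfree ?row_free_unit // eqmxMfull // row_full_unit unitmx_inv.
Qed.

(** * Frobenius norm and singular values *)

Lemma sqr_frobenius (R : realType) (m n : nat) (B : 'M[R]_(m, n)) :
  frobenius B ^+ 2 = \tr (B^T *m B).
Proof.
rewrite sqr_sqrtr; last first.
  by apply: sumr_ge0 => i _; apply: sumr_ge0 => j _; exact: sqr_ge0.
rewrite exchange_big; apply: eq_bigr => j _; rewrite mxE.
by apply: eq_bigr => i _; rewrite mxE expr2.
Qed.

Lemma sqr_l2norm (R : realType) (n : nat) (v : 'cV[R]_n) :
  l2norm v ^+ 2 = frobenius v ^+ 2.
Proof. by congr (Num.sqrt _ ^+ 2); apply: eq_bigr => i _; rewrite big_ord1. Qed.

Lemma frobenius_eq0 (R : realType) (m n : nat) (B : 'M[R]_(m, n)) :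
  frobenius B ^+ 2 = 0 -> B = 0.
Proof.
rewrite sqr_sqrtr => [B0|]; last first.
  by do 2 (apply: sumr_ge0 => ? _); exact: sqr_ge0.
apply/matrixP => i j; apply/eqP; rewrite mxE -sqrf_eq0; apply/eqP.
have Bi0 : \sum_j B i j ^+ 2 = 0.
  apply: (psumr_eq0P _ B0) => // k _; apply: sumr_ge0 => l _; exact: sqr_ge0.
by apply: (psumr_eq0P _ Bi0) => // k _; exact: sqr_ge0.
Qed.

(** For a row eigenvector [v], the squared norm of [v *m B^T] is [a] times that of [v], which is
    positive. *)
Lemma eigenvalue_gram_ge0 (R : realType) (m n : nat) (B : 'M[R]_(m, n))
    (a : R) :
  eigenvalue (B^T *m B) a -> 0 <= a.
Proof.
case/eigenvalueP => v vB v0.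
have sqr w (k : nat) (u : 'M[R]_(k, w)) : frobenius u ^+ 2 = \tr (u *m u^T).
  by rewrite sqr_frobenius mxtrace_mulC.
have : frobenius (v *m B^T) ^+ 2 = a * frobenius v ^+ 2.
  by rewrite !sqr trmx_mul trmxK mulmxA -(mulmxA v) vB -scalemxAl mxtraceZ.
have v_gt0 : 0 < frobenius v ^+ 2.
  by rewrite lt_def sqr_ge0 andbT; apply: contra_neq v0 => /frobenius_eq0.
by move=> E; rewrite -(pmulr_lge0 _ v_gt0) -E sqr_ge0.
Qed.

Lemma max_singular_value_bounds (R : realType) (m n : nat) (B : 'M[R]_(m, n)) :
    (0 < n)%N ->
  max_singular_value B ^+ 2 <= frobenius B ^+ 2
    <= (\rank B)%:R * max_singular_value B ^+ 2.
Proof.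
move=> n_gt0; set M := B^T *m B.
have Msym : M^T = M by rewrite /M trmx_mul trmxK.
have [d [chiM trM rkM]] := symmetric_spectrum Msym.
have eigE a : eigenvalue M a = [exists i, d ord0 i == a].
  rewrite eigenvalue_root_char chiM rootE horner_prod.
  apply/prodf_eq0/existsP => [[i _]|[i /eqP <-]]; last first.
    by exists i; rewrite // hornerXsubC subrr.
  by rewrite hornerXsubC subr_eq0 eq_sym; exists i.
have d_ge0 i : 0 <= d ord0 i.
  apply: (eigenvalue_gram_ge0 (B := B)).
  by rewrite -/M eigE; apply/existsP; exists i.
have sumE : frobenius B ^+ 2 = \sum_i d ord0 i by rewrite sqr_frobenius trM.
have le_sum i : d ord0 i <= \sum_i d ord0 i.
  by rewrite (bigD1 i) //= lerDl; exact: sumr_ge0.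
have frob_ge0 : 0 <= frobenius B := sqrtr_ge0 _.
(* The square of a singular value is one term of a nonnegative sum equal to the squared Frobenius
   norm. This both makes [sup] meaningful and gives the lower inequality. *)
have ubS : ubound (singular_values B) (frobenius B).
  move=> s [s_ge0]; rewrite -/M eigE => /existsP[i /eqP ds].
  by rewrite -(ler_pXn2r (n := 2)) // sumE -ds.
have sqrtS i : singular_values B (Num.sqrt (d ord0 i)).
  split; rewrite ?sqrtr_ge0 // sqr_sqrtr // -/M eigE.
  by apply/existsP; exists i.
(* Here [0 < n] provides an eigenvalue, hence the nonemptiness that [sup] requires. *)
have S0 : (singular_values B !=set0)%classic.
  by exists (Num.sqrt (d ord0 (Ordinal n_gt0))).
have sqrt_le i : Num.sqrt (d ord0 i) <= max_singular_value B.
  by apply: sup_upper_bound (sqrtS i); split => //; exists (frobenius B).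
have max_ge0 : 0 <= max_singular_value B.
  exact: le_trans (sqrtr_ge0 _) (sqrt_le (Ordinal n_gt0)).
have d_le i : d ord0 i <= max_singular_value B ^+ 2.
  by rewrite -[leLHS]sqr_sqrtr // lerXn2r ?nnegrE ?sqrtr_ge0.
apply/andP; split; first by rewrite lerXn2r ?nnegrE // ge_sup.
(* Dropping the zero eigenvalues leaves at most [\rank (B^T *m B)] terms, hence at most [\rank B],
   each bounded by the squared maximum. *)
rewrite sumE (bigID (fun i => d ord0 i == 0)) /= big1 ?add0r => [|i /eqP //].
apply: le_trans (ler_sum _ (fun i _ => d_le i)) _.
rewrite sumr_const -[leLHS]mulr_natl ler_wpM2r ?sqr_ge0 // ler_nat.
apply: leq_trans (card_neq0_rank_diag _) _.
by rewrite -rkM mxrankM_maxr.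
Qed.

(** * Norms of PLD matrices and the error ratio *)

(** The norm of the rank-one matrix [y *m p^T] is the product of the norms of [y] and [p]; the
    factor in front clears the denominator of the closed form. *)
Lemma sqr_frobenius_PLD (R : realType) (n m : nat) (alpha : R) (p : 'cV[R]_m)
    (y : 'cV[R]_n) : 0 < alpha -> p != 0 ->
  l2norm (alpha *: p) ^+ 2 * frobenius (PLD alpha p y) ^+ 2 = l2norm y ^+ 2.
Proof.
move=> alpha_gt0 p0.
have p1 : l2norm p ^+ 2 != 0.
  by apply: contra_neq p0; rewrite sqr_l2norm => /frobenius_eq0.
have frobZ a k l (B : 'M[R]_(k, l)) :
    frobenius (a *: B) ^+ 2 = a ^+ 2 * frobenius B ^+ 2.
  rewrite !sqr_frobenius [(a *: B)^T]linearZ /=.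
  by rewrite -scalemxAl -scalemxAr scalerA mxtraceZ.
have frobM : frobenius (y *m p^T) ^+ 2 = l2norm y ^+ 2 * l2norm p ^+ 2.
  rewrite !sqr_l2norm !sqr_frobenius trmx_mul trmxK.
  rewrite mxtrace_mulC mulmxA -(mulmxA y) [p^T *m p]mx11_scalar mul_mx_scalar.
  by rewrite -scalemxAl mxtraceZ mxtrace_mulC mulrC mxtrace_scalar.
rewrite frobZ frobM !sqr_l2norm frobZ -!sqr_l2norm.
have alpha0 := lt0r_neq0 alpha_gt0; set q := l2norm p ^+ 2 in p1 *.
by field; rewrite p1.
Qed.

(** The PLD matrix is a multiple of [y *m p^T], so [H *m p = 0] kills both cross terms in the
    trace. *)
Lemma sqr_frobenius_PLD_add (R : realType) (n m : nat) (alpha : R)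
    (p : 'cV[R]_m) (y : 'cV[R]_n) (H : 'M[R]_(n, m)) : H *m p = 0 ->
  frobenius (PLD alpha p y + H) ^+ 2
    = frobenius (PLD alpha p y) ^+ 2 + frobenius H ^+ 2.
Proof.
move=> Hp; set A := PLD alpha p y.
have tr k l (B : 'M[R]_(k, l)) : frobenius B ^+ 2 = \tr (B *m B^T).
  by rewrite sqr_frobenius mxtrace_mulC.
have HA : H *m A^T = 0.
  rewrite /A /PLD linearZ /= trmx_mul trmxK.
  by rewrite -scalemxAr mulmxA Hp mul0mx scaler0.
have AH : A *m H^T = 0 by rewrite -[A]trmxK -trmx_mul HA trmx0.
by rewrite !tr linearD /= mulmxDl !mulmxDr HA AH addr0 add0r mxtraceD.
Qed.

(** The two occurrences of [t] are bounded independently, the numerator at one end of the interval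
    and the denominator at the other. *)
Lemma ler_ratio_addr (R : realFieldType) (a b lo t hi : R) :
    0 <= a -> 0 <= lo -> lo <= t <= hi -> 0 < b + lo ->
  (a + lo) / (b + hi) <= (a + t) / (b + t) <= (a + hi) / (b + lo).
Proof.
move=> a_ge0 lo_ge0 /andP[lo_t t_hi] den_gt0.
have bt : 0 < b + t by lra.
have bhi : 0 < b + hi by lra.
apply/andP; split; apply: ler_pM; rewrite ?invr_ge0 ?lef_pV2 ?posrE //; lra.
Qed.

Theorem mainTheorem1 (R : realType) (m : nat) (hm : (1 <= m)%N)
    (p : 'cV[R]_m) (hp : p != 0) (alpha : R) (halpha : 0 < alpha)
    (x xhat : 'cV[R]_24) (A Ahat Atilde H : 'M[R]_(24, m))
    (hA : A = PLD alpha p x) (hAhat : Ahat = PLD alpha p xhat)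
    (hAtilde0 : Atilde != 0) (hAtilde : Atilde *m (alpha *: p) = x)
    (hH : Atilde = A + H)
    (RH : nat) (hRH : RH = \rank H)
    (sigma1 : R) (hsigma1 : sigma1 = max_singular_value H) :
  Num.sqrt ((l2norm (xhat - x) ^+ 2 + l2norm (alpha *: p) ^+ 2 * sigma1 ^+ 2)
            / (l2norm x ^+ 2 + l2norm (alpha *: p) ^+ 2 * RH%:R * sigma1 ^+ 2))
    <= frobenius (Ahat - Atilde) / frobenius Atilde
  /\
  frobenius (Ahat - Atilde) / frobenius Atilde
    <= Num.sqrt ((l2norm (xhat - x) ^+ 2
                  + l2norm (alpha *: p) ^+ 2 * RH%:R * sigma1 ^+ 2)
                 / (l2norm x ^+ 2 + l2norm (alpha *: p) ^+ 2 * sigma1 ^+ 2)).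
Proof.
have q_neq0 : alpha *: p != 0 by rewrite scaler_eq0 gt_eqF.
have q_gt0 : 0 < l2norm (alpha *: p) ^+ 2.
  rewrite lt_def sqr_ge0 andbT; apply: contra_neq q_neq0.
  by rewrite sqr_l2norm => /frobenius_eq0.
have Hp : H *m p = 0.
  have Ax : A *m (alpha *: p) = x.
    by have [] := (is_PLDP halpha hp x A).2 hA.
  have : H *m (alpha *: p) = 0.
    apply: (addrI x); rewrite addr0 -{1}Ax -mulmxDl -hH hAtilde //.
  by rewrite -scalemxAr => /eqP; rewrite scaler_eq0 gt_eqF //= => /eqP.
have numE : l2norm (alpha *: p) ^+ 2 * frobenius (Ahat - Atilde) ^+ 2 =
    l2norm (xhat - x) ^+ 2 + l2norm (alpha *: p) ^+ 2 * frobenius H ^+ 2.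
  (* [PLD] is linear in the load curve, so the error is again a PLD matrix plus a matrix
     annihilating [p]. *)
  have -> : Ahat - Atilde = PLD alpha p (xhat - x) + (- H).
    by rewrite hH hA hAhat /PLD mulmxBl scalerBr opprD addrA.
  rewrite sqr_frobenius_PLD_add ?mulNmx ?Hp ?oppr0 // mulrDr.
  rewrite sqr_frobenius_PLD // [frobenius (- H) ^+ 2]sqr_frobenius.
  by rewrite [(- H)^T]linearN /= mulNmx mulmxN opprK -sqr_frobenius.
have denE : l2norm (alpha *: p) ^+ 2 * frobenius Atilde ^+ 2 =
    l2norm x ^+ 2 + l2norm (alpha *: p) ^+ 2 * frobenius H ^+ 2.
  by rewrite hH hA sqr_frobenius_PLD_add // mulrDr sqr_frobenius_PLD.
have Atilde_gt0 : 0 < frobenius Atilde ^+ 2.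
  by rewrite lt_def sqr_ge0 andbT; apply: contra_neq hAtilde0 => /frobenius_eq0.
have /andP[lo hi] := max_singular_value_bounds H hm.
rewrite -hsigma1 -hRH in lo hi.
have ratioE : frobenius (Ahat - Atilde) / frobenius Atilde = Num.sqrt
    ((l2norm (xhat - x) ^+ 2 + l2norm (alpha *: p) ^+ 2 * frobenius H ^+ 2) /
     (l2norm x ^+ 2 + l2norm (alpha *: p) ^+ 2 * frobenius H ^+ 2)).
  (* The common factor, the squared norm of [alpha *: p], cancels from the quotient. *)
  rewrite -numE -denE -mulf_div divff ?gt_eqF // mul1r -expr_div_n sqrtr_sqr.
  by rewrite ger0_norm // divr_ge0 ?sqrtr_ge0.
have lo_ge0 : 0 <= l2norm (alpha *: p) ^+ 2 * sigma1 ^+ 2.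
  by apply: mulr_ge0; exact: sqr_ge0.
have den_gt0 : 0 < l2norm x ^+ 2 + l2norm (alpha *: p) ^+ 2 * sigma1 ^+ 2.
  rewrite lt_def andbC addr_ge0 ?sqr_ge0 //=.
  (* If x and sigma1 both vanish, then ||H||_F = 0 and so Atilde = 0. *)
  apply/eqP => /eqP; rewrite paddr_eq0 ?sqr_ge0 //.
  rewrite [X in _ && X]mulf_eq0 (gt_eqF q_gt0) /= => /andP[/eqP x0 /eqP s0].
  move: Atilde_gt0; rewrite -(pmulr_rgt0 _ q_gt0) denE x0 add0r.
  by rewrite (pmulr_rgt0 _ q_gt0) ltNge (le_trans hi) // s0 mulr0.
rewrite ratioE -(mulrA _ RH%:R).
have /andP[] : (l2norm (xhat - x) ^+ 2 + l2norm (alpha *: p) ^+ 2 * sigma1 ^+ 2)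
      / (l2norm x ^+ 2 + l2norm (alpha *: p) ^+ 2 * (RH%:R * sigma1 ^+ 2))
    <= (l2norm (xhat - x) ^+ 2 + l2norm (alpha *: p) ^+ 2 * frobenius H ^+ 2)
      / (l2norm x ^+ 2 + l2norm (alpha *: p) ^+ 2 * frobenius H ^+ 2)
    <= (l2norm (xhat - x) ^+ 2
        + l2norm (alpha *: p) ^+ 2 * (RH%:R * sigma1 ^+ 2))
      / (l2norm x ^+ 2 + l2norm (alpha *: p) ^+ 2 * sigma1 ^+ 2).
  by apply: ler_ratio_addr; rewrite ?sqr_ge0 // !ler_pM2l // lo hi.
by move=> ? ?; split; apply: ler_wsqrtr.
Qed.
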